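(* Let $m\ge1$ be an integer, let $1<p\le q<\infty$ and $\gamma=\frac mp-\frac1q$. There is a finite constant $C$, depending only on $m,p,q$, such that for every $H\in L^p(\Lambda_m)$ the function $$\psi(x)=x^\gamma\,[(T\otimes\cdots\otimes T)H](x,\dots,x),\qquad x>0,$$ satisfies $$\|\psi\|_{L^q[0,\infty)}\le C\,\|H\|_{L^p(\Lambda_m)}.$$
   Context: $\Lambda_m=[0,\infty)^m$ with Lebesgue measure. $T$ is the Hardy operator $(Tf)(x)=\frac1x\int_0^xf(t)\,dt$, $x>0$, and $T\otimes\cdots\otimes T$ ($m$ factors) is its tensor-product extension to functions on $\Lambda_m$: $[(T\otimes\cdots\otimes T)H](x_1,\dots,x_m)=\frac1{x_1\cdots x_m}\int_0^{x_1}\!\cdots\int_0^{x_m}H(t_1,\dots,t_m)\,dt_m\cdots dt_1$. *)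

(* Defs.v *)
From HB Require Import structures.
From mathcomp Require Import all_boot all_order all_algebra.
From mathcomp Require Import all_classical all_reals all_analysis.
From mathcomp Require Import measurable_realfun.

Set Implicit Arguments.
Unset Strict Implicit.
Unset Printing Implicit Defensive.
Import Order.TTheory GRing.Theory Num.Theory.
Import numFieldNormedType.Exports.

Local Open Scope classical_set_scope.
Local Open Scope ring_scope.
Local Open Scope ereal_scope.

(* The library has the product sigma-algebra on n.-tuple T but no product
   measure there: the measure mu x nu on T x T^n is transported to T^n.+1. *)
Section cons_product.
Context d (T : measurableType d) (R : realType) (n : nat).
Variables (mu : {sigma_finite_measure set T -> \bar R})
  (nu : {sigma_finite_measure set (n.-tuple T) -> \bar R}).

Definition pair_cons (z : T * n.-tuple T) : n.+1.-tuple T :=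
  [tuple of z.1 :: z.2].

Definition cons_product : set (n.+1.-tuple T) -> \bar R :=
  pushforward (mu \x nu) pair_cons.

Lemma measurable_pair_cons : measurable_fun [set: T * n.-tuple T] pair_cons.
Proof. exact: measurable_cons. Qed.

Let cons_product0 : cons_product set0 = 0.
Proof. by apply: measure0; exact: measurable_pair_cons. Qed.

Let cons_product_ge0 A : 0 <= cons_product A.
Proof. by apply: measure_ge0; exact: measurable_pair_cons. Qed.

Let cons_product_sigma_additive : semi_sigma_additive cons_product.
Proof.
by apply: measure_semi_sigma_additive; exact: measurable_pair_cons.
Qed.

HB.instance Definition _ := isMeasure.Build _ _ _ cons_product
  cons_product0 cons_product_ge0 cons_product_sigma_additive.

Lemma cons_productE (A : set T) (B : set (n.-tuple T)) :
  measurable A -> measurable B ->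
  cons_product [set t | A (thead t) /\ B [tuple of behead t]] = mu A * nu B.
Proof.
move=> mA mB; rewrite -product_measure1E//; congr ((mu \x nu) _).
have behK (x : T) (t : n.-tuple T) : [tuple of behead [tuple of x :: t]] = t.
  exact/val_inj.
by apply/seteqP; split=> -[x t] /=; rewrite behK.
Qed.

Let cons_product_sigma_finite : sigma_finite [set: n.+1.-tuple T] cons_product.
Proof.
have /sigma_finiteP[F [TF ndF Foo]] := sigma_finiteT mu.
have /sigma_finiteP[G [TG ndG Goo]] := sigma_finiteT nu.
exists (fun k => [set t | F k (thead t) /\ G k [tuple of behead t]]).
  apply/seteqP; split=> // t _.
  have [i _ Fi] : (\bigcup_i F i) (thead t) by rewrite -TF.
  have [j _ Gj] : (\bigcup_i G i) [tuple of behead t] by rewrite -TG.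
  exists (maxn i j) => //; split.
  - by move: Fi; exact/subsetPset/ndF/leq_maxl.
  - by move: Gj; exact/subsetPset/ndG/leq_maxr.
move=> k; have [mF Fk] := Foo k; have [mG Gk] := Goo k; split.
  apply: measurableI.
  - by rewrite -[X in measurable X]setTI; exact: measurable_tnth.
  - by rewrite -[X in measurable X]setTI; exact: measurable_behead.
by rewrite cons_productE// lte_mul_pinfty// ge0_fin_numE.
Qed.

HB.instance Definition _ := Measure_isSigmaFinite.Build _ _ _ cons_product
  cons_product_sigma_finite.

End cons_product.

Section hardy_tensor.
Context {R : realType}.

Fixpoint lebesgue_tuple (n : nat) :
    {sigma_finite_measure set (n.-tuple (measurableTypeR R)) -> \bar R} :=
  match n with
  | 0 => \d_([tuple] : 0.-tuple (measurableTypeR R))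
  | n'.+1 => cons_product (@lebesgue_measure R) (lebesgue_tuple n')
  end.

Definition Lambda (m : nat) : set (m.-tuple (measurableTypeR R)) :=
  [set x | forall i, (0 <= tnth x i)%R].

(* The iterated integral of H over [0, x_1] x ... x [0, x_m], the one over the
   first coordinate being outermost. Values are kept in \bar R because H is only
   p-integrable: a section of H may fail to be integrable on a null set. *)
Fixpoint iter_integral (m : nat) :
    (m.-tuple (measurableTypeR R) -> \bar R) ->
    m.-tuple (measurableTypeR R) -> \bar R :=
  match m with
  | 0 => fun H _ => H [tuple]
  | m'.+1 => fun H x =>
      \int[lebesgue_measure]_(t in `[0%R, thead x])
        iter_integral (fun s : m'.-tuple _ => H [tuple of t :: s])
          [tuple of behead x]
  end.

Definition hardy_tensor (m : nat) (H : m.-tuple (measurableTypeR R) -> R)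
    (x : m.-tuple (measurableTypeR R)) : \bar R :=
  ((\prod_(i < m) tnth x i)^-1)%:E * iter_integral (EFin \o H) x.

Definition hardy_diag (m : nat) (gamma : R)
    (H : m.-tuple (measurableTypeR R) -> R) (x : R) : \bar R :=
  (x `^ gamma)%:E * hardy_tensor H [tuple of nseq m x].

Lemma lebesgue_tuple_box (n : nat) (A : 'I_n -> set (measurableTypeR R)) :
  (forall i, measurable (A i)) ->
  lebesgue_tuple n [set x | forall i, A i (tnth x i)] =
  \prod_(i < n) lebesgue_measure (A i).
Proof.
elim: n A => [|n IH] A mA.
  by rewrite big_ord0 /= diracE mem_set// => -[].
rewrite big_ord_recl -IH//.
rewrite -(@cons_productE _ _ _ _ lebesgue_measure (lebesgue_tuple n))//.
  congr (cons_product _ _ _); apply/seteqP.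
  have behK (y : measurableTypeR R) (t : n.-tuple (measurableTypeR R)) :
      [tuple of behead [tuple of y :: t]] = t by exact/val_inj.
  split; case/tupleP => y t /=; rewrite theadE behK.
  - move=> Ax; split=> [|i]; first exact: (Ax ord0).
    by rewrite -(tnthS y); exact: Ax.
  - move=> [A0 A1] i; have [<-//|] := eqVneq ord0 i.
    by case/unlift_some => j -> _; rewrite tnthS; exact: A1.
rewrite (_ : [set _ | _] = \bigcap_(i : 'I_n)
    ((fun x : n.-tuple (measurableTypeR R) => tnth x i) @^-1` A (lift ord0 i))).
  apply: fin_bigcap_measurable => // i _.
  by rewrite -[X in measurable X]setTI; exact: measurable_tnth.
by apply/seteqP; split=> x /= Ax i; [move=> _|]; exact: Ax.
Qed.

End hardy_tensor.
Arguments Lambda {R} m.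

(* Main.v *)
(* With the cube Q_x = ]0, x]^m and w(t) = t_1 ... t_m, Hoelder's inequality
   against the weight w^((p-1)/(2p)) gives
     (\int_(Q_x) |H|)^p <= (2 x^(1/2))^(m(p-1)) K(x),
     K(x) = \int_(Q_x) |H|^p w^((p-1)/2).
   Put e = m(p-1)/2 and V(x) = x^(-2e) (\int_(Q_x) |H|)^p, so that
   |psi(x)|^q <= x^(-1) V(x)^(q/p). Since w <= x^m on Q_x, V is bounded by a
   multiple of ||H||_p^p, which pays for the factor V^(q/p-1); for the remaining
   factor, V(x) is at most a multiple of x^(-e) K(x), and by Tonelli
   \int x^(-1-e) K(x) dx = \int |H(t)|^p w(t)^((p-1)/2) (max t)^(-e) / e dt
   is at most ||H||_p^p / e because w(t) <= (max t)^m. *)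
Require Import Defs.
From mathcomp Require Import all_boot all_order all_algebra.
From mathcomp Require Import all_classical all_reals all_analysis.
From mathcomp Require Import measurable_realfun.
From mathcomp Require Import ring.
Set Implicit Arguments.
Unset Strict Implicit.
Unset Printing Implicit Defensive.
Import Order.TTheory GRing.Theory Num.Theory.
Import numFieldNormedType.Exports.
Local Open Scope classical_set_scope.
Local Open Scope ring_scope.

(** * Iterated integrals: measurability, and reduction to integrals over boxes *)

Section iterated_integrals.
Context {R : realType}.
Local Notation T := (measurableTypeR R).
Local Notation leb := (@lebesgue_measure R).
Local Open Scope ereal_scope.

(** Tonelli's measurability statement is applied to the positive and negative parts of [f].
    Integrability does not enter, because the integral is by definition the difference of the two
    parts in [\bar R]. *)
Lemma measurable_fun_integral_snd d1 d2 (X : measurableType d1)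
    (Y : measurableType d2) (mu : {sigma_finite_measure set Y -> \bar R})
    (f : X * Y -> \bar R) :
  measurable_fun setT f -> measurable_fun setT (fun x => \int[mu]_y f (x, y)).
Proof.
move=> mf; under eq_fun do rewrite integralE.
apply: emeasurable_funB.
- rewrite (_ : (fun _ => _) = fubini_F mu f^\+).
    by apply: measurable_fun_fubini_tonelli_F => //; exact: measurable_funepos.
  by apply/funext => x; apply: eq_integral => y _; rewrite !funeposE.
- rewrite (_ : (fun _ => _) = fubini_F mu f^\-).
    by apply: measurable_fun_fubini_tonelli_F => //; exact: measurable_funeneg.
  by apply/funext => x; apply: eq_integral => y _; rewrite !funenegE.
Qed.

Lemma measurable_thead d (U : measurableType d) n :
  measurable_fun [set: n.+1.-tuple U] (fun t => thead t).
Proof. exact: measurable_tnth. Qed.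

(* The parameter space Y grows by one real variable at each induction step. *)
Lemma measurable_iter_integral m d (Y : measurableType d)
    (f : Y * m.-tuple T -> \bar R) : measurable_fun setT f ->
  measurable_fun setT
    (fun z : Y * m.-tuple T => iter_integral (fun s => f (z.1, s)) z.2).
Proof.
elim: m d Y f => [|m IH] d Y f mf /=.
  apply: (measurableT_comp mf); exact: measurable_fun_pair.
(* The variable upper limit becomes the indicator of a measurable set, so that the integral runs
   over the whole line for every parameter. *)
pose A := [set w : (Y * m.+1.-tuple T) * T | (0 <= w.2 <= thead w.1.2)%R].
have mA : measurable A.
  have mth : measurable_fun setT (fun w : (Y * m.+1.-tuple T) * T => thead w.1.2).
    apply: measurableT_comp; first exact: measurable_thead.
    exact: measurableT_comp.
  have -> : A = (setT `&` [set w | (0 <= w.2)%R]) `&`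
                (setT `&` [set w | (w.2 <= thead w.1.2)%R]).
    by rewrite !setTI; apply/seteqP; split=> w /= => [/andP[]//|[? ?]]; exact/andP.
  by apply: measurableI; apply: measurable_fun_le.
pose g (w : (Y * m.+1.-tuple T) * T) :=
  iter_integral (fun s => f (w.1.1, [tuple of w.2 :: s])) [tuple of behead w.1.2].
have mg : measurable_fun setT g.
  have mf' : measurable_fun setT
      (fun u : (Y * T) * m.-tuple T => f (u.1.1, [tuple of u.1.2 :: u.2])).
    apply: (measurableT_comp mf); apply: measurable_fun_pair.
      exact: measurableT_comp.
    by apply: measurable_cons => //; exact: measurableT_comp.
  apply: (measurableT_comp (IH _ _ _ mf')
    (g := fun w : (Y * m.+1.-tuple T) * T =>
      ((w.1.1, w.2), [tuple of behead w.1.2]))).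
  apply: measurable_fun_pair.
    by apply: measurable_fun_pair => //; exact: measurableT_comp.
  apply: (measurableT_comp (@measurable_behead _ _ _)).
  exact: (measurableT_comp measurable_snd measurable_fst).
have mgA : measurable_fun setT (g \_ A).
  by apply/(measurable_restrictT _ mA); exact: measurable_funTS.
apply: eq_measurable_fun (measurable_fun_integral_snd leb mgA).
move=> z _; rewrite [RHS]integral_mkcond; apply: eq_integral => t _.
rewrite /patch/=; congr (if _ then _ else _).
Qed.

Lemma measurable_tuple_cons d1 d2 (U : measurableType d1) (X : measurableType d2)
    n (f : n.+1.-tuple U -> X) (t : U) :
  measurable_fun setT f ->
  measurable_fun setT (fun s : n.-tuple U => f [tuple of t :: s]).
Proof. by move=> mf; apply: (measurableT_comp mf); exact: measurable_cons. Qed.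

(** The measure on tuples is the image of a product measure under [pair_cons]: a change of variables
    followed by Tonelli splits off the first coordinate. *)
Lemma ge0_integral_lebesgue_tupleS n (f : n.+1.-tuple T -> \bar R) :
  measurable_fun setT f -> (forall t, 0 <= f t) ->
  \int[lebesgue_tuple n.+1]_t f t =
  \int[leb]_t \int[lebesgue_tuple n]_s f [tuple of t :: s].
Proof.
move=> mf f0.
rewrite [LHS](ge0_integral_pushforward (@measurable_pair_cons _ _ n))//.
rewrite preimage_setT.
rewrite (fubini_tonelli1 (f \o @pair_cons _ T n))//.
  by apply: measurableT_comp => //; exact: measurable_pair_cons.
by move=> x /=.
Qed.

(* Open at 0, so that a product of powers of the coordinates is invertible on the
   box; recall that 0 `^ r = 0 for r != 0. *)
Definition obox n (x : n.-tuple T) : set (n.-tuple T) :=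
  [set s | forall i, (0 < tnth s i <= tnth x i)%R].

Lemma oboxS n (x s : n.-tuple T) (a t : T) :
  obox [tuple of a :: x] [tuple of t :: s] <-> (0 < t <= a)%R /\ obox x s.
Proof.
split=> [h|[h0 h] i].
  split; first exact: (h ord0).
  by move=> i; have := h (lift ord0 i); rewrite !tnthS.
have [<-//|] := eqVneq ord0 i.
by case/unlift_some => j -> _; rewrite !tnthS; exact: h.
Qed.

Lemma measurable_obox n (x : n.-tuple T) : measurable (obox x).
Proof.
rewrite (_ : obox x = \bigcap_(i : 'I_n)
    ((fun s : n.-tuple T => tnth s i) @^-1` `]0%R, tnth x i])).
  apply: fin_bigcap_measurable => // i _.
  by rewrite -[X in measurable X]setTI; exact: measurable_tnth.
apply/seteqP; split=> s /= h i; first by move=> _; rewrite /= in_itv/=; exact: h.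
by have := h i Logic.I; rewrite /= in_itv.
Qed.

(** All the integrals start at 0, so only nonnegative coordinates are sampled. This lets [H] be
    replaced by its restriction to [Lambda m]. *)
Lemma eq_iter_integral n (f g : n.-tuple T -> \bar R) (x : n.-tuple T) :
  {in Lambda n, f =1 g} -> iter_integral f x = iter_integral g x.
Proof.
elim: n f g x => [|n IH] f g x fg /=; first by apply: fg; rewrite inE => -[].
apply: eq_integral => t; rewrite inE/= in_itv/= => /andP[t0 _].
apply: IH => s; rewrite inE => s0; apply: fg; rewrite inE => i.
have [<-//|] := eqVneq ord0 i.
by case/unlift_some => j -> _; rewrite tnthS.
Qed.

Lemma measurable_iter_integral_cons n (f : n.+1.-tuple T -> \bar R)
    (x : n.-tuple T) : measurable_fun setT f ->
  measurable_fun setT (fun t : T => iter_integral (fun s => f [tuple of t :: s]) x).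
Proof.
move=> mf.
have mf' : measurable_fun setT (fun z : T * n.-tuple T => f [tuple of z.1 :: z.2]).
  by apply: (measurableT_comp mf); exact: measurable_cons.
apply: (measurableT_comp (measurable_iter_integral mf')
  (g := fun t : T => (t, x))).
exact: measurable_fun_pair.
Qed.

(** Triangle inequality for the outer integral, then induction under it. It reduces the bound on the
    diagonal to nonnegative functions, for which Tonelli is available. *)
Lemma le_abse_iter_integral n (f : n.-tuple T -> \bar R) (x : n.-tuple T) :
  measurable_fun setT f ->
  `|iter_integral f x| <= iter_integral (abse \o f) x.
Proof.
elim: n f x => [|n IH] f x mf //=.
have mi := measurable_iter_integral_cons [tuple of behead x] mf.
have mi' := measurable_iter_integral_cons [tuple of behead x]
  (measurableT_comp (@abse_measurable R setT) mf).
apply: (le_trans (le_abse_integral _ _ _)) => //; first exact: measurable_funTS.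
apply: ge0_le_integral => //.
- by apply: measurableT_comp => //; exact: measurable_funTS.
- exact: measurable_funTS.
- by move=> t _; apply: IH; exact: measurable_tuple_cons.
Qed.

Lemma ge0_iter_integralE n (f : n.-tuple T -> \bar R) (x : n.-tuple T) :
  measurable_fun setT f -> (forall s, 0 <= f s) ->
  iter_integral f x = \int[lebesgue_tuple n]_(s in obox x) f s.
Proof.
elim: n f x => [|n IH] f x mf f0.
  rewrite /= integral_dirac//; last 2 first.
  - exact: measurable_obox.
  - exact: measurable_funTS.
  by rewrite diracE mem_set ?mul1e// => -[].
case/tupleP: x => a y.
rewrite [LHS]/= theadE (_ : [tuple of behead [tuple of a :: y]] = y); last first.
  exact/val_inj.
rewrite [RHS]integral_mkcond ge0_integral_lebesgue_tupleS; last 2 first.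
- exact: (measurable_restrictT f (measurable_obox [tuple of a :: y])).1
    (measurable_funTS mf).
- by move=> t; exact: erestrict_ge0.
(* [iter_integral] uses intervals closed at 0 and [obox] intervals open at 0; the endpoint is a null
   set. *)
rewrite -integral_itv_obnd_cbnd; last first.
  by apply: measurable_funTS; exact: measurable_iter_integral_cons.
rewrite [LHS]integral_mkcond; apply: eq_integral => t _.
rewrite /patch; case: ifPn => [|ta].
  rewrite inE/= in_itv/= => ta.
  rewrite IH//; last exact: measurable_tuple_cons.
  rewrite [LHS]integral_mkcond; apply: eq_integral => s _.
  rewrite /patch; congr (if _ then _ else _).
  by apply/idP/idP; rewrite !inE oboxS => // -[].
rewrite integral0_eq// => s _; rewrite ifN//.
apply: contra ta; rewrite !inE oboxS => -[ta _].
by rewrite /= in_itv.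
Qed.

End iterated_integrals.

(** * Integrals of powers over intervals, and of products of one-variable functions *)

Section power_integrals.
Context {R : realType}.
Local Notation T := (measurableTypeR R).
Local Notation leb := (@lebesgue_measure R).
Local Open Scope ereal_scope.

Lemma continuous_powR_gt0 (e t : R) : (0 < t)%R ->
  {for t, continuous (@powR R ^~ e)}.
Proof.
move=> t0; apply: differentiable_continuous; apply/derivable1_diffP.
by apply: derivable_powR; rewrite in_itv/= t0.
Qed.

Lemma integral_powR (a b e : R) : (0 < a < b)%R -> e != 0%R ->
  \int[leb]_(t in `[a, b]) (t `^ (e - 1))%:E = ((b `^ e - a `^ e) / e)%:E.
Proof.
move=> /andP[a0 ab] e0.
have pos x : x \in `[a, b]%R -> (0 < x)%R.
  by rewrite in_itv/= => /andP[ax _]; exact: lt_le_trans ax.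
have b0 : (0 < b)%R by exact: lt_trans ab.
have cP x : (0 < x)%R -> {for x, continuous (fun t : R => e^-1 * t `^ e)%R}.
  by move=> x0; apply: cvgM; [exact: cvg_cst|exact: continuous_powR_gt0].
rewrite (@continuous_FTC2 _ _ (fun t => e^-1 * t `^ e)%R)//.
- by rewrite -EFinB mulrBl !(mulrC e^-1)%R.
- apply: continuous_in_subspaceT => x; rewrite inE => /pos x0.
  exact: continuous_powR_gt0.
- split.
  + move=> x xab; have x0 : (0 < x)%R by apply: pos; exact: subset_itv_oo_cc xab.
    by apply: derivableM => //; apply: derivable_powR; rewrite in_itv/= x0.
  + by apply: cvg_at_right_filter; exact: cP.
  + by apply: cvg_at_left_filter; exact: cP.
- move=> x xab; have x0 : (0 < x)%R by apply: pos; exact: subset_itv_oo_cc xab.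
  have dx := @is_derive1_powR R e x x0.
  rewrite derive1E (@derive_val _ _ _ _ _ _ _ (is_deriveZ e^-1 dx)).
  by rewrite /GRing.scale/= mulrA mulVf// mul1r.
Qed.

(** Empty and one-point intervals are covered too, so that the bound applies to every member of an
    exhausting sequence. *)
Lemma integral_powR_le (a b e c : R) : (0 < a)%R -> e != 0%R -> (0 <= c)%R ->
  ((a < b)%R -> ((b `^ e - a `^ e) / e <= c)%R) ->
  \int[leb]_(t in `[a, b]) (t `^ (e - 1))%:E <= c%:E.
Proof.
move=> a0 e0 c0 abc; have [ab|ba|->] := ltgtP a b.
- by rewrite integral_powR ?a0//= lee_fin abc.
- by rewrite set_itv_ge ?integral_set0 ?lee_fin// bnd_simp -ltNge.
- by rewrite set_itv1 integral_set1 lee_fin.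
Qed.

(** Monotone convergence carries a bound that is uniform along an exhaustion to the improper
    integral. *)
Lemma integral_powR_cvg_le (F : (set T)^nat) (e c : R) :
  (forall n, measurable (F n)) -> nondecreasing_seq F ->
  (forall n, \int[leb]_(t in F n) (t `^ (e - 1))%:E <= c%:E) ->
  \int[leb]_(t in \bigcup_n F n) (t `^ (e - 1))%:E <= c%:E.
Proof.
move=> mF ndF Fc.
have h : \int[leb]_(t in F i) (t `^ (e - 1))%:E @[i --> \oo] -->
    \int[leb]_(t in \bigcup_i F i) (t `^ (e - 1))%:E.
  apply: ge0_nondecreasing_set_cvg_integral => //.
  - move=> i; apply/measurable_EFinP; apply: measurable_funTS.
    exact: measurable_powR.
  - by move=> i x _; rewrite lee_fin powR_ge0.
rewrite -(cvg_lim _ h)//; apply: lime_le; first by apply/cvg_ex; eexists; exact: h.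
exact: nearW.
Qed.

Lemma integral_powR_0b_le (b e : R) : (0 < b)%R -> (0 < e)%R ->
  \int[leb]_(t in `]0%R, b]) (t `^ (e - 1))%:E <= (b `^ e / e)%:E.
Proof.
move=> b0 e0; rewrite itv_open_bnd_bigcup; apply: integral_powR_cvg_le => //.
- move=> m n mn; rewrite subsetEset; apply: subset_itvr.
  by rewrite bnd_simp lerD2l lef_pV2 ?posrE// ler_nat.
- move=> n; apply: integral_powR_le.
  + by rewrite add0r.
  + by rewrite gt_eqF.
  + by rewrite divr_ge0 ?powR_ge0 ?ltW.
  + by move=> _; rewrite ler_pM2r ?invr_gt0// gerBl powR_ge0.
Qed.

(** Dividing by the negative exponent exchanges the roles of the endpoints: here the term of the
    primitive at the upper endpoint is the one dropped. *)
Lemma integral_powR_ay_le (a e : R) : (0 < a)%R -> (0 < e)%R ->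
  \int[leb]_(t in `[a, +oo[) (t `^ (- e - 1))%:E <= (a `^ (- e) / e)%:E.
Proof.
move=> a0 e0; rewrite itv_bndy_bigcup_BRight; apply: integral_powR_cvg_le => //.
- move=> m n mn; rewrite subsetEset; apply: subset_itvl.
  by rewrite bnd_simp lerD2l ler_nat.
- move=> n; apply: integral_powR_le => //.
  + by rewrite oppr_eq0 gt_eqF.
  + by rewrite divr_ge0 ?powR_ge0 ?ltW.
  + move=> _; rewrite invrN mulrN -mulNr ler_pM2r ?invr_gt0// opprB.
    by rewrite gerBl powR_ge0.
Qed.

(** Serves the second Hoelder factor, whose weight is a product over the coordinates. *)
Lemma ge0_integral_lebesgue_tuple_prod n (g : T -> R) :
  measurable_fun setT g -> (forall t, (0 <= g t)%R) ->
  \int[lebesgue_tuple n]_s (\prod_(i < n) g (tnth s i))%:E =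
  (\int[leb]_t (g t)%:E) ^+ n.
Proof.
move=> mg g0; have mp k : measurable_fun setT
    (fun s : k.-tuple T => (\prod_(i < k) g (tnth s i))%:E).
  apply/measurable_EFinP; apply: measurable_prod => i _.
  by apply: measurableT_comp => //; exact: measurable_tnth.
have p0 k (s : k.-tuple T) : (0 <= \prod_(i < k) g (tnth s i))%R.
  exact: prodr_ge0.
elim: n => [|n IH].
  by rewrite integral_dirac//=; [rewrite diracE mem_set// mul1e big_ord0|exact: mp].
rewrite ge0_integral_lebesgue_tupleS//; last by move=> s; rewrite lee_fin.
rewrite expeS -ge0_integralZr//; last 3 first.
- exact/measurable_EFinP.
- by move=> t _; rewrite lee_fin.
- by apply: expe_ge0; apply: integral_ge0 => t _; rewrite lee_fin.
apply: eq_integral => t _; rewrite -IH -ge0_integralZl//; last 3 first.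
- exact: mp.
- by move=> s _; rewrite lee_fin.
- by rewrite lee_fin.
apply: eq_integral => s _; rewrite big_ord_recl EFinM; congr (_ * (_)%:E).
by apply: eq_bigr => i _; rewrite tnthS.
Qed.

End power_integrals.

(** * Hoelder's inequality on a cube, weighted by a power of the product of the coordinates *)

Section weighted_hoelder.
Context {R : realType}.
Local Notation T := (measurableTypeR R).
Local Notation leb := (@lebesgue_measure R).
Local Open Scope ereal_scope.

Lemma lee_wpexpn2r (x y : \bar R) n : 0 <= x -> x <= y -> x ^+ n <= y ^+ n.
Proof.
move=> x0 xy; elim: n => [|n IH]; first by rewrite !expe0.
by rewrite !expeS lee_pmul// expe_ge0.
Qed.

Definition tprod n (s : n.-tuple T) : R := (\prod_(i < n) tnth s i)%R.

Lemma measurable_tprod n : measurable_fun setT (@tprod n).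
Proof. by apply: measurable_prod => i _; exact: measurable_tnth. Qed.

Lemma tprod_gt0 n (x s : n.-tuple T) : obox x s -> (0 < tprod s)%R.
Proof. by move=> xs; apply: prodr_gt0 => i _; case/andP: (xs i). Qed.

Lemma powR_prod n (s : 'I_n -> R) (r : R) : (forall i, 0 < s i)%R ->
  ((\prod_(i < n) s i) `^ r = \prod_(i < n) (s i `^ r))%R.
Proof.
elim: n s => [|n IH] s s0; first by rewrite !big_ord0 powR1.
rewrite !big_ord_recl powRM ?IH//; first exact: ltW.
by apply: prodr_ge0 => i _; exact: ltW.
Qed.

Lemma measurable_tprod_powR n (r : R) :
  measurable_fun setT (fun s : n.-tuple T => (tprod s `^ r)%R).
Proof.
apply: (measurableT_comp (measurable_powR r)); exact: measurable_tprod.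
Qed.

(** The weight and the indicator of the cube both factor over the coordinates, leaving the [n]-th
    power of a one-variable integral. The exponent -1/2 is written [2^-1 - 1] to match
    [integral_powR_0b_le] at [e = 2^-1]. *)
Lemma integral_tprod_powR_le n (x : R) : (0 < x)%R ->
  \int[lebesgue_tuple n]_(s in obox [tuple of nseq n x])
     (tprod s `^ (2^-1 - 1))%:E <= ((x `^ 2^-1 / 2^-1) ^+ n)%:E.
Proof.
move=> x0.
pose g : T -> R := (fun t => t `^ (2^-1 - 1))%R \_ `]0%R, x].
have g0 t : (0 <= g t)%R by rewrite /g patchE; case: ifP; rewrite ?powR_ge0.
have mg : measurable_fun setT g.
  apply/(measurable_restrictT _ (measurable_itv _)); apply: measurable_funTS.
  exact: measurable_powR.
rewrite integral_mkcond.
rewrite (_ : \int[_]_t _ =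
    \int[lebesgue_tuple n]_s (\prod_(i < n) g (tnth s i))%:E).
  rewrite ge0_integral_lebesgue_tuple_prod// EFin_expe; apply: lee_wpexpn2r.
  - by apply: integral_ge0 => t _; rewrite lee_fin.
  - rewrite (le_trans _ (integral_powR_0b_le x0 _))// [leRHS]integral_mkcond.
    by rewrite le_eqVlt; apply/orP; left; apply/eqP; apply: eq_integral => t _;
      rewrite /g !patchE; case: ifP.
apply: eq_integral => s _; rewrite patchE; case: ifPn => [|].
  rewrite inE => xs; congr EFin; rewrite /tprod powR_prod; last first.
    by move=> i; case/andP: (xs i).
  apply: eq_bigr => i _; rewrite /g patchE mem_set//= in_itv/=.
  by have := xs i; rewrite tnth_nseq.
(* Outside the cube some coordinate leaves []0, x]], and its factor [g] annihilates the product. *)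
rewrite notin_setE => xs.
have [i xi] : exists i, ~~ (0 < tnth s i <= x)%R.
  apply/existsP; rewrite -negb_forall; apply/negP => /forallP xs'.
  by apply: xs => i; rewrite tnth_nseq; exact: xs'.
rewrite (bigD1 i)//= {1}/g patchE memNset ?mul0r//=.
by rewrite in_itv/=; exact/negP.
Qed.

Lemma hoelder_obox n (p x : R) (h : n.-tuple T -> R) : (1 < p)%R -> (0 < x)%R ->
  measurable_fun setT h -> (forall s, 0 <= h s)%R ->
  (\int[lebesgue_tuple n]_(s in obox [tuple of nseq n x]) (h s)%:E) `^ p <=
  (((x `^ 2^-1 / 2^-1) ^+ n) `^ (p - 1))%:E *
  \int[lebesgue_tuple n]_(s in obox [tuple of nseq n x])
     (h s `^ p * tprod s `^ ((p - 1) / 2))%:E.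
Proof.
move=> p1 x0 mh h0; set B := obox _; set mu := lebesgue_tuple n.
have mB : measurable B by exact: measurable_obox.
have p0 : (0 < p)%R by exact: lt_trans p1.
have pN0 : p != 0%R by rewrite gt_eqF.
have p10 : (0 < p - 1)%R by rewrite subr_gt0.
have p1N0 : (p - 1 != 0)%R by rewrite gt_eqF.
pose p' := (p / (p - 1))%R; have p'0 : (0 < p')%R by rewrite divr_gt0.
(* Chosen so that [b * p = (p - 1) / 2] and, for the conjugate exponent [p'], [b * p' = 1 / 2]: the
   second factor then involves only the integrable weight [tprod s] to the power -1/2. *)
pose b := ((p - 1) / (2 * p))%R.
have mw r := @measurable_tprod_powR n r.
pose f := (fun s => h s * tprod s `^ b)%R \_ B.
pose g := (fun s => tprod s `^ (- b))%R \_ B.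
have mf : measurable_fun setT f.
  by apply/(measurable_restrictT _ mB); apply: measurable_funTS;
    exact: measurable_funM.
have mg : measurable_fun setT g.
  by apply/(measurable_restrictT _ mB); exact: measurable_funTS.
have pp' : (p^-1 + p'^-1 = 1)%R.
  by rewrite /p' invf_div -[X in (X + _)%R]div1r -mulrDl addrC subrK divff.
have := hoelder mu mf mg p0 p'0 pp'.
rewrite Lnorm1.
have -> : \int[mu]_s `|(EFin \o (f \* g)%R) s| = \int[mu]_(s in B) (h s)%:E.
  rewrite [RHS]integral_mkcond; apply: eq_integral => s _.
  (* On the box [tprod] is positive and the two weights cancel; off the box both sides vanish. *)
  rewrite /= /f /g !patchE; case: ifPn => [|_]; last by rewrite mulr0 normr0.
  rewrite inE => /tprod_gt0 w0; rewrite -mulrA -powRD; last first.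
    by rewrite (gt_eqF w0) implybT.
  by rewrite subrr powRr0 mulr1 ger0_norm.
move=> H.
apply: (@le_trans _ _ (('N[mu]_p%:E[EFin \o f] * 'N[mu]_p'%:E[EFin \o g]) `^ p)).
  apply: gt0_ler_poweR => //; rewrite ?in_itv/= ?leey ?andbT.
  - exact: ltW.
  - by apply: integral_ge0 => s _; rewrite lee_fin.
  - by apply: mule_ge0; exact: Lnorm_ge0.
rewrite poweRM ?Lnorm_ge0// muleC poweR_Lnorm//; apply: lee_pmul.
- exact: poweR_ge0.
- by apply: integral_ge0 => s _; exact: poweR_ge0.
(* Since [p = p' * (p - 1)], the [p]-th power of the [p']-norm is the underlying integral raised to
   [p - 1]. *)
- rewrite -[X in _ `^ X](mulfVK p1N0 p) -/p' poweRrM poweR_Lnorm ?gt_eqF//.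
  rewrite -poweR_EFin; apply: gt0_ler_poweR; rewrite ?in_itv/= ?leey ?andbT.
  + exact: ltW.
  + by apply: integral_ge0 => s _; rewrite lee_fin powR_ge0.
  + by rewrite lee_fin exprn_ge0// divr_ge0// powR_ge0.
  rewrite (le_trans _ (integral_tprod_powR_le n x0))// [leRHS]integral_mkcond.
  rewrite le_eqVlt; apply/orP; left; apply/eqP; apply: eq_integral => s _.
  rewrite /= /g !patchE; case: ifPn => [|_]; last first.
    by rewrite normr0 powR0// gt_eqF.
  rewrite inE => /tprod_gt0 w0; rewrite ger0_norm ?powR_ge0// -powRrM.
  by congr (_ `^ _)%:E; rewrite /b /p'; field; rewrite p1N0 pN0.
- rewrite [leRHS]integral_mkcond.
  rewrite le_eqVlt; apply/orP; left; apply/eqP; apply: eq_integral => s _.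
  rewrite /= /f !patchE; case: ifPn => [|_]; last first.
    by rewrite normr0 powR0// gt_eqF.
  rewrite inE => /tprod_gt0 w0; rewrite ger0_norm ?mulr_ge0 ?powR_ge0//.
  rewrite powRM ?powR_ge0// -powRrM.
  by congr (_ * _ `^ _)%:E; rewrite /b; field.
Qed.

End weighted_hoelder.

(** * Cubes as a family in their side: Tonelli in the side, and pointwise interpolation *)

Section cubes.
Context {R : realType}.
Local Notation T := (measurableTypeR R).
Local Notation leb := (@lebesgue_measure R).
Local Open Scope ereal_scope.

Definition cube n (x : T) : set (n.-tuple T) := obox [tuple of nseq n x].

Lemma cubeP n (x : T) (s : n.-tuple T) :
  cube x s <-> forall i, (0 < tnth s i <= x)%R.
Proof. by split=> xs i; have := xs i; rewrite tnth_nseq. Qed.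

(** Joint measurability in the side and the point is what permits exchanging the integrals over [x]
    and [s]. *)
Lemma measurable_cube_graph n :
  measurable [set z : T * n.-tuple T | cube z.1 z.2].
Proof.
pose Z := (T * n.-tuple T)%type.
rewrite (_ : [set _ | _] = \bigcap_(i : 'I_n)
   ((setT `&` [set z : Z | (0 < tnth z.2 i)%R]) `&`
    (setT `&` [set z : Z | (tnth z.2 i <= z.1)%R]))).
  apply: fin_bigcap_measurable => // i _.
  have mi : measurable_fun setT (fun z : Z => tnth z.2 i).
    apply: (measurableT_comp (@measurable_tnth _ _ n i)); exact: measurable_snd.
  apply: measurableI; last by apply: measurable_fun_le => //; exact: measurable_fst.
  rewrite (_ : setT `&` _ = setT `&` (fun z : Z => tnth z.2 i) @^-1` `]0%R, +oo[).
    exact: mi.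
  by apply/seteqP; split=> z /=; rewrite in_itv/= andbT.
apply/seteqP; split=> z /=; rewrite cubeP => h i.
  by move=> _ /=; have /andP[] := h i.
by apply/andP; have [[_ ?] [_ ?]] := h i Logic.I.
Qed.

Lemma measurable_integral_cube n (f : n.-tuple T -> \bar R) :
  measurable_fun setT f ->
  measurable_fun setT (fun x : T => \int[lebesgue_tuple n]_(s in cube x) f s).
Proof.
move=> mf.
pose D := [set z : T * n.-tuple T | cube z.1 z.2].
have mfD : measurable_fun setT ((fun z : T * n.-tuple T => f z.2) \_ D).
  apply/(measurable_restrictT _ (@measurable_cube_graph n)).
  apply: measurable_funTS; apply: measurableT_comp => //.
apply: eq_measurable_fun (measurable_fun_integral_snd (lebesgue_tuple n) mfD).
move=> x _; rewrite [RHS]integral_mkcond; apply: eq_integral => s _.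
by rewrite !patchE; congr (if _ then _ else _); apply/idP/idP; rewrite !inE.
Qed.

(** [M] is the largest coordinate, which exists because [0 < n]; the sides whose cube contains [s]
    form the ray from [M]. *)
Lemma cube_max n (s : n.-tuple T) : (0 < n)%N -> (forall i, 0 < tnth s i)%R ->
  exists2 M : T, (0 < M)%R &
    (forall x, cube x s <-> (M <= x)%R) /\ (tprod s <= M ^+ n)%R.
Proof.
move=> n0 s0.
have [i _ iM] := @arg_maxP _ _ _ (Ordinal n0) xpredT (tnth s) isT.
exists (tnth s i) => //; split.
  move=> x; rewrite cubeP; split=> [/(_ i)/andP[]//|ix j].
  by rewrite s0/= (le_trans _ ix)//; exact: iM.
rewrite /tprod -[X in (_ ^+ X)%R]card_ord -prodr_const.
by apply: ler_prod => j _; rewrite ltW//=; exact: iM.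
Qed.

(** Tonelli moves the integral over [x] inside. For fixed [s] with positive coordinates it runs over
    [[M, +oo[] and contributes at most [M^(-e) / e], which absorbs the weight because
    [tprod s ^ c <= M^e]. *)
Lemma integral_cube_powR_le n (c : R) (u : n.-tuple T -> R) : (0 < n)%N ->
  (0 < c)%R -> measurable_fun setT u -> (forall s, 0 <= u s)%R ->
  \int[leb]_x ((x `^ (- (n%:R * c) - 1))%:E *
    \int[lebesgue_tuple n]_(s in cube x) (u s * tprod s `^ c)%:E) <=
  ((n%:R * c)^-1)%:E * \int[lebesgue_tuple n]_s (u s)%:E.
Proof.
move=> n0 c0 mu u0; set e := (n%:R * c)%R.
have e0 : (0 < e)%R by rewrite mulr_gt0 ?ltr0n.
pose D := [set z : T * n.-tuple T | cube z.1 z.2].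
have mD : measurable D by exact: measurable_cube_graph.
pose G (z : T * n.-tuple T) : \bar R :=
  (z.1 `^ (- e - 1))%:E * (u z.2 * tprod z.2 `^ c)%:E.
have G0 z : 0 <= G z by rewrite mule_ge0// lee_fin ?mulr_ge0 ?powR_ge0.
have mw : measurable_fun setT (fun s => u s * tprod s `^ c)%R.
  by apply: measurable_funM => //; exact: measurable_tprod_powR.
have mG : measurable_fun setT (G \_ D).
  apply/(measurable_restrictT _ mD); apply: measurable_funTS.
  apply: emeasurable_funM; apply/measurable_EFinP.
    apply: (measurableT_comp (@measurable_powR R _)); exact: measurable_fst.
  apply: (measurableT_comp mw); exact: measurable_snd.
have GD0 z : 0 <= (G \_ D) z by exact: erestrict_ge0.
rewrite (_ : \int[leb]_x _ =
    \int[leb]_x fubini_F (lebesgue_tuple n) (G \_ D) x); last first.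
  apply: eq_integral => x _; rewrite /fubini_F.
  rewrite [X in _ * X]integral_mkcond -ge0_integralZl//; last 3 first.
  - apply/(measurable_restrictT _ (measurable_obox _)).
    by apply: measurable_funTS; exact/measurable_EFinP.
  - by move=> s _; apply: erestrict_ge0 => {}s _; rewrite lee_fin mulr_ge0 ?powR_ge0.
  - by rewrite lee_fin powR_ge0.
  apply: eq_integral => s _; rewrite !patchE.
  have -> : ((x, s) \in D) = (s \in cube x) by apply/idP/idP; rewrite !inE.
  by case: ifP; rewrite ?mule0.
rewrite fubini_tonelli// -ge0_integralZl//; last 3 first.
- exact/measurable_EFinP.
- by move=> s _; rewrite lee_fin.
- by rewrite lee_fin invr_ge0 ltW.
apply: ge0_le_integral => //.
- by move=> s _; exact: integral_ge0.
- exact: measurable_fun_fubini_tonelli_G.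
- by apply: measurable_funeM; exact/measurable_EFinP.
move=> s _; rewrite /fubini_G.
(* A point with a nonpositive coordinate lies in no cube, so its inner integral is zero. *)
have [s0|] := pselect (forall i, 0 < tnth s i)%R; last first.
  move=> s0; rewrite integral0_eq.
    by rewrite mule_ge0// lee_fin// invr_ge0 ltW.
  move=> x _; rewrite patchE memNset// => /cubeP xs; apply: s0 => i.
  by case/andP: (xs i).
have [M M0 [xM wM]] := cube_max n0 s0.
rewrite (_ : \int[_]_x _ = \int[leb]_(x in `[M, +oo[) ((u s * tprod s `^ c)%:E *
    (x `^ (- e - 1))%:E)); last first.
  rewrite [RHS]integral_mkcond; apply: eq_integral => x _; rewrite !patchE /G muleC.
  congr (if _ then _ else _); apply/idP/idP; rewrite !inE /D/= in_itv/= andbT.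
    by move/xM.
  by move=> ?; exact/xM.
rewrite ge0_integralZl//; last 3 first.
- by apply/measurable_EFinP; apply: measurable_funTS; exact: measurable_powR.
- by move=> x _; rewrite lee_fin powR_ge0.
- by rewrite lee_fin mulr_ge0 ?powR_ge0.
apply: (@le_trans _ _ ((u s * tprod s `^ c)%:E * (M `^ (- e) / e)%:E)).
  rewrite lee_wpmul2l ?lee_fin ?mulr_ge0 ?powR_ge0//.
  exact: integral_powR_ay_le.
rewrite -!EFinM lee_fin mulrA [leRHS]mulrC ler_pM2r ?invr_gt0//.
rewrite -mulrA ler_piMr// powRN ler_pdivrMr ?powR_gt0// mul1r /e powRrM.
rewrite (powR_mulrn _ (ltW M0)); apply: ge0_ler_powR => //; rewrite ?nnegrE.
- exact: ltW.
- by apply/ltW/prodr_gt0 => i _.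
- by rewrite exprn_ge0// ltW.
Qed.

Lemma tprod_cube_le n (x : T) (s : n.-tuple T) :
  cube x s -> (tprod s <= x ^+ n)%R.
Proof.
move=> /cubeP xs; rewrite /tprod -[X in (_ ^+ X)%R]card_ord -prodr_const.
by apply: ler_prod => i _; case/andP: (xs i) => /ltW -> ->.
Qed.

(** Here [g] stands for the integral of [|H|] over the cube of side [x], [k] for [K(x)] and [r] for
    the [p]-th power of the norm of [H]. The resulting bound is linear in [k], which makes it
    accessible to the Tonelli estimate. *)
Lemma powR_interpolation (n : nat) (p q x g k r : R) :
  (1 < p)%R -> (p <= q)%R -> (0 < x)%R -> (0 <= g)%R -> (0 <= k)%R ->
  (0 <= r)%R ->
  let e := (n%:R * ((p - 1) / 2))%R in let B := ((2 ^+ n) `^ (p - 1))%R in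
  (g `^ p <= ((x `^ 2^-1 / 2^-1) ^+ n) `^ (p - 1) * k)%R ->
  (k <= x `^ e * r)%R ->
  ((x `^ (n%:R / p - q^-1) * (x ^+ n)^-1 * g) `^ q <=
   B `^ (q / p) * r `^ (q / p - 1) * (x `^ (- e - 1) * k))%R.
Proof.
move=> p1 pq x0 g0 k0 r0 e B gk kr.
have p0 : (0 < p)%R by exact: lt_trans p1.
have q0 : (0 < q)%R by exact: lt_le_trans pq.
have pN0 : p != 0%R by rewrite gt_eqF.
have qN0 : q != 0%R by rewrite gt_eqF.
have qp0 : (0 < q / p)%R by rewrite divr_gt0.
have B0 : (0 <= B)%R by exact: powR_ge0.
have xD a b : (x `^ (a + b) = x `^ a * x `^ b)%R.
  by rewrite powRD// (gt_eqF x0) implybT.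
(* Separates the powers of 2, collected in [B], from those of [x], whose total exponent is
   [n (p - 1) / 2 = e]. *)
have BE : (((x `^ 2^-1 / 2^-1) ^+ n) `^ (p - 1) = B * x `^ e)%R.
  rewrite invrK exprMn mulrC powRM ?exprn_ge0 ?powR_ge0//; congr (_ * _)%R.
  rewrite -powR_mulrn ?powR_ge0// -!powRrM; congr (_ `^ _)%R.
  by rewrite /e; ring.
(* This is V(x) of the overview, to be bounded once through [k] and once, uniformly in [x], through
   [r]. *)
pose v := (x `^ (- (2 * e)) * g `^ p)%R.
have v0 : (0 <= v)%R by rewrite mulr_ge0 ?powR_ge0.
have vk : (v <= B * (x `^ (- e) * k))%R.
  rewrite /v (_ : - (2 * e) = - e + - e)%R; last by ring.
  rewrite xD.
  have -> : (B * (x `^ (- e) * k) = x `^ (- e) * x `^ (- e) * (B * x `^ e * k))%R.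
    by rewrite !powRN; field; rewrite gt_eqF ?powR_gt0.
  by rewrite ler_wpM2l ?mulr_ge0 ?powR_ge0// -BE.
have vr : (v <= B * r)%R.
  apply: (le_trans vk); rewrite ler_wpM2l// powRN mulrC ler_pdivrMr ?powR_gt0//.
  by rewrite mulrC.
(* The exponents of [x] agree: [q (n/p - 1/q - n) = -1 - 2 e q/p]. *)
have -> : ((x `^ (n%:R / p - q^-1) * (x ^+ n)^-1 * g) `^ q =
    x `^ (-1) * v `^ (q / p))%R.
  have xn0 : (0 <= (x ^+ n)^-1)%R by rewrite invr_ge0 exprn_ge0 ?ltW.
  rewrite (powRM _ (mulr_ge0 (powR_ge0 _ _) xn0) g0) (powRM _ (powR_ge0 _ _) xn0).
  rewrite /v (powRM _ (powR_ge0 _ _) (powR_ge0 _ _)).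
  rewrite -(powR_mulrn _ (ltW x0)) -powRN -!powRrM mulrA -!xD.
  congr (_ `^ _ * _ `^ _)%R; last by field.
  by rewrite /e; field; rewrite pN0 qN0.
(* One factor [v] is kept for the bound through [k]; the remaining power [q / p - 1] is nonnegative
   as [p <= q], hence monotone, and takes the bound through [r]. *)
rewrite -(mulr_powRB1 v0 qp0) -(mulr_powRB1 B0 qp0).
rewrite (_ : - e - 1 = -1 + - e)%R; last by ring.
rewrite xD.
have vBr : (v `^ (q / p - 1) <= B `^ (q / p - 1) * r `^ (q / p - 1))%R.
  rewrite -powRM//; apply: ge0_ler_powR; rewrite ?nnegrE ?v0 ?mulr_ge0//.
  by rewrite subr_ge0 ler_pdivlMr// mul1r.
rewrite (_ : B * B `^ (q / p - 1) * r `^ (q / p - 1) *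
    (x `^ (-1) * x `^ (- e) * k) =
  x `^ (-1) * (B * (x `^ (- e) * k) * (B `^ (q / p - 1) * r `^ (q / p - 1))))%R; last by ring.
by rewrite ler_wpM2l ?powR_ge0// ler_pM ?powR_ge0.
Qed.

End cubes.

(** * The diagonal of the Hardy tensor: pointwise bound, integral bound and norm inequality *)

Section hardy_diag_bound.
Context {R : realType}.
Local Notation T := (measurableTypeR R).
Local Notation leb := (@lebesgue_measure R).
Local Open Scope ereal_scope.

Lemma measurable_hardy_diag n (gamma : R) (H : n.-tuple T -> R) :
  measurable_fun setT H ->
  measurable_fun (`]0%R, +oo[%classic : set R) (hardy_diag gamma H).
Proof.
move=> mH; have mnseq : measurable_fun setT (fun x : T => [tuple of nseq n x]).
  apply/measurable_fun_tnthP => i.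
  apply: eq_measurable_fun (@measurable_id _ T setT) => x _.
  by rewrite /= tnth_nseq.
(* The inverse of the product is written as a power of [x], so that each factor is measurable on the
   whole line; agreement with [hardy_diag] is claimed for [x > 0]. *)
pose F (x : T) := (x `^ gamma)%:E * ((x `^ (- n%:R))%:E *
  iter_integral (EFin \o H) [tuple of nseq n x]).
apply: (@eq_measurable_fun _ _ _ _ _ F) => [x|].
  rewrite inE/= in_itv/= andbT => x0; rewrite /F /hardy_diag /hardy_tensor.
  rewrite powR_invn ?ltW//; congr (_ * (_^-1%:E * _)).
  by under [RHS]eq_bigr do rewrite tnth_nseq; rewrite prodr_const card_ord.
apply: measurable_funTS.
apply: emeasurable_funM; first by apply/measurable_EFinP; exact: measurable_powR.
apply: emeasurable_funM; first by apply/measurable_EFinP; exact: measurable_powR.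
(* A trivial parameter space [unit] suffices: only the dependence on the endpoint tuple matters
   here. *)
have mf : measurable_fun setT (fun z : unit * n.-tuple T => (H z.2)%:E).
  apply/measurable_EFinP; apply: (measurableT_comp mH); exact: measurable_snd.
apply: (measurableT_comp (measurable_iter_integral mf)
  (g := fun x : T => (tt, [tuple of nseq n x]))).
exact: measurable_fun_pair.
Qed.

Lemma abse_hardy_diag_le n (gamma : R) (H : n.-tuple T -> R) (x : R) :
  (0 < x)%R -> measurable_fun setT H ->
  `|hardy_diag gamma H x| <= (x `^ gamma * (x ^+ n)^-1)%:E *
     \int[lebesgue_tuple n]_(s in cube x) `|H s|%:E.
Proof.
move=> x0 mH; rewrite /hardy_diag /hardy_tensor muleA -EFinM abseM.
have -> : (\prod_(i < n) tnth [tuple of nseq n x] i = x ^+ n)%R.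
  by under eq_bigr do rewrite tnth_nseq; rewrite prodr_const card_ord.
have c0 : (0 <= x `^ gamma * (x ^+ n)^-1)%R.
  by rewrite mulr_ge0 ?powR_ge0// invr_ge0 exprn_ge0// ltW.
rewrite /= (ger0_norm c0) lee_wpmul2l ?lee_fin//.
have mEH : measurable_fun setT (EFin \o H) by exact/measurable_EFinP.
rewrite (le_trans (le_abse_iter_integral _ mEH))// ge0_iter_integralE//.
  exact: measurableT_comp.
by move=> s; exact: abse_ge0.
Qed.

(** In the pointwise bound everything but [x^(-e-1) K(x)] is constant in [x]; the Tonelli estimate
    turns that factor into [r / e], which completes [r^(q/p - 1)] to [r^(q/p)]. *)
Lemma integral_hardy_diag_powR_le n (p q r : R) (H : n.-tuple T -> R) :
  (0 < n)%N -> (1 < p)%R -> (p <= q)%R -> measurable_fun setT H ->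
  (0 <= r)%R -> \int[lebesgue_tuple n]_s (`|H s| `^ p)%:E = r%:E ->
  \int[leb]_(x in `]0%R, +oo[) (`|hardy_diag (n%:R / p - q^-1) H x| `^ q) <=
  (((2 ^+ n) `^ (p - 1)) `^ (q / p) / (n%:R * ((p - 1) / 2)) * r `^ (q / p))%:E.
Proof.
move=> n0 p1 pq mH r0 Hr; set B : R := ((2 ^+ n) `^ (p - 1))%R.
have p0 : (0 < p)%R by exact: lt_trans p1.
have q0 : (0 < q)%R by exact: lt_le_trans pq.
have qp0 : (0 < q / p)%R by rewrite divr_gt0.
have c0 : (0 < (p - 1) / 2)%R by rewrite divr_gt0// subr_gt0.
pose e := (n%:R * ((p - 1) / 2))%R.
have mabs : measurable_fun setT (fun s => `|H s|%R) by exact: measurableT_comp.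
pose u s := (`|H s| `^ p)%R.
have mu : measurable_fun setT u.
  exact: (measurableT_comp (measurable_powR p)).
have u0 s : (0 <= u s)%R by exact: powR_ge0.
pose v s := (u s * tprod s `^ ((p - 1) / 2))%R.
have v0 s : (0 <= v s)%R by rewrite mulr_ge0 ?powR_ge0.
have mv : measurable_fun setT v.
  by apply: measurable_funM => //; exact: measurable_tprod_powR.
pose K x := \int[lebesgue_tuple n]_(s in cube x) (v s)%:E.
have K0 x : 0 <= K x by apply: integral_ge0 => s _; rewrite lee_fin.
have mK : measurable_fun setT K.
  by apply: measurable_integral_cube; exact/measurable_EFinP.
pose A := (B `^ (q / p) * r `^ (q / p - 1))%R.
have A0 : (0 <= A)%R by rewrite mulr_ge0 ?powR_ge0.
have mpow : measurable_fun setT (fun x : T => (x `^ (- e - 1))%:E * K x).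
  by apply: emeasurable_funM => //; apply/measurable_EFinP; exact: measurable_powR.
have pow0 x : 0 <= (x `^ (- e - 1))%:E * K x by rewrite mule_ge0 ?lee_fin ?powR_ge0.
apply: (@le_trans _ _ (\int[leb]_(x in `]0%R, +oo[)
    (A%:E * ((x `^ (- e - 1))%:E * K x)))).
  apply: ge0_le_integral => //.
  - by move=> x _; exact: poweR_ge0.
  - apply: (measurableT_comp (@measurable_poweR R q)) => //.
    by apply: measurableT_comp => //; exact: measurable_hardy_diag.
  - by apply: measurable_funTS; apply: measurable_funeM.
  move=> x; rewrite /= in_itv/= andbT => x0.
  (* On the cube [tprod s <= x^n], so the weight is at most [x^e]; enlarging the cube to the whole
     space leaves [r]. *)
  have kr : K x <= (x `^ e * r)%:E.
    rewrite EFinM -Hr -ge0_integralZl//; last 2 first.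
    - exact/measurable_EFinP.
    - by rewrite lee_fin powR_ge0.
    apply: (@le_trans _ _
        (\int[lebesgue_tuple n]_(s in cube x) ((x `^ e)%:E * (u s)%:E))).
      apply: ge0_le_integral => //.
      - exact: measurable_obox.
      - by move=> s _; rewrite lee_fin.
      - by apply: measurable_funTS; exact/measurable_EFinP.
      - apply: measurable_funTS; apply: measurable_funeM; exact/measurable_EFinP.
      move=> s xs; rewrite -EFinM lee_fin /v mulrC ler_wpM2r//.
      rewrite /e (powRrM x) (powR_mulrn _ (ltW x0)); apply: ge0_ler_powR.
      - exact: ltW.
      - by rewrite nnegrE (ltW (tprod_gt0 xs)).
      - by rewrite nnegrE exprn_ge0// ltW.
      exact: tprod_cube_le.
    apply: ge0_subset_integral => //.
    - exact: measurable_obox.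
    - by apply: measurable_funeM; exact/measurable_EFinP.
    - by move=> s _; rewrite -EFinM lee_fin mulr_ge0 ?powR_ge0.
  have Kfin : K x \is a fin_num.
    by rewrite ge0_fin_numE// (le_lt_trans kr)// ltry.
  have := hoelder_obox p1 x0 mabs (fun s => normr_ge0 _).
  rewrite -/(cube x) -/(K x).
  set g := \int[_]_(s in _) _ => gk.
  have g0 : 0 <= g by apply: integral_ge0 => s _; rewrite lee_fin.
  (* Hoelder's bound with a finite [K x] forces the integral of [|H|] over the cube to be finite, so
     the estimate can be carried out in [R]. *)
  have gfin : g \is a fin_num.
    rewrite ge0_fin_numE//; apply: (@lty_poweRy _ _ p); first by rewrite gt_eqF.
    by rewrite (le_lt_trans gk)// -(fineK Kfin) -EFinM ltry.
  apply: (@le_trans _ _ (((x `^ (n%:R / p - q^-1) * (x ^+ n)^-1)%:E * g) `^ q)).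
    apply: gt0_ler_poweR; rewrite ?in_itv/= ?leey ?andbT ?abse_ge0//.
    - exact: ltW.
    - by rewrite mule_ge0// lee_fin mulr_ge0 ?powR_ge0// invr_ge0 exprn_ge0// ltW.
    exact: abse_hardy_diag_le.
  move: gk kr; rewrite -(fineK gfin) -(fineK Kfin) poweR_EFin -!EFinM poweR_EFin.
  rewrite !lee_fin => gk kr.
  apply: powR_interpolation => //; exact: fine_ge0.
rewrite ge0_integralZl//; last first.
  exact: measurable_funTS.
have -> : (B `^ (q / p) / (n%:R * ((p - 1) / 2)) * r `^ (q / p))%:E =
    A%:E * (e^-1%:E * r%:E).
  rewrite -!EFinM -(mulr_powRB1 r0 qp0) /A /e; congr EFin; ring.
rewrite lee_wpmul2l ?lee_fin// -Hr.
apply: le_trans (integral_cube_powR_le n0 c0 mu u0).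
by apply: ge0_subset_integral => //; exact: measurable_itv.
Qed.

End hardy_diag_bound.

Unset Implicit Arguments.

Theorem theorem7 (R : realType) (m : nat) (p q : R) (m_ge1 : (1 <= m)%N)
    (p_gt1 : 1 < p) (p_le_q : p <= q) :
  exists C : R, forall H : m.-tuple (measurableTypeR R) -> R,
    H \_ (Lambda m) \in Lfun (lebesgue_tuple m) p%:E ->
    let psi := hardy_diag (m%:R / p - q^-1) H in
    measurable_fun (`]0, +oo[%classic : set R) psi /\
    ('N[lebesgue_measure]_q%:E[psi \_ `]0%R, +oo[]
      <= C%:E * 'N[lebesgue_tuple m]_p%:E[(EFin \o H) \_ (Lambda m)])%E.
Proof.
have p0 : 0 < p by exact: lt_trans p_gt1.
have q0 : 0 < q by exact: lt_le_trans p_le_q.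
pose B : R := (2 ^+ m) `^ (p - 1).
pose D : R := B `^ (q / p) / (m%:R * ((p - 1) / 2)).
have D0 : 0 <= D.
  by rewrite divr_ge0 ?powR_ge0// mulr_ge0// divr_ge0// subr_ge0 ltW.
(* [D] bounds the [q]-th power of the norm of [psi], hence the [q]-th root. *)
exists (D `^ q^-1) => H HL psi; pose H' := H \_ (Lambda m).
(* [psi] sees [H] only on [Lambda m], and it is the restriction [H'] that is measurable with finite
   norm by hypothesis. *)
have psiE : psi = hardy_diag (m%:R / p - q^-1) H'.
  apply/funext => x; rewrite /psi /hardy_diag /hardy_tensor; congr (_ * (_ * _))%E.
  apply: eq_iter_integral => s sL; congr EFin.
  by rewrite /H' patchE sL.
have mH' : measurable_fun setT H'.
  by move: HL => /sub_Lfun_mfun; rewrite inE.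
have finH' : ('N[lebesgue_tuple m]_p%:E[EFin \o H'] < +oo)%E.
  by move: HL => /sub_Lfun_finLfun; rewrite inE.
rewrite psiE; split; first exact: measurable_hardy_diag.
rewrite restrict_EFin -/H'.
pose N := (\int[lebesgue_tuple m]_s (`|H' s| `^ p)%:E)%E.
have N0 : (0 <= N)%E by apply: integral_ge0 => s _; rewrite lee_fin powR_ge0.
have NE : ('N[lebesgue_tuple m]_p%:E[EFin \o H'] = N `^ p^-1)%E.
  by rewrite unlock.
have Nfin : N \is a fin_num.
  rewrite ge0_fin_numE//; move: finH'; rewrite NE; apply: lty_poweRy.
  by rewrite invr_eq0 gt_eqF.
have := integral_hardy_diag_powR_le m_ge1 p_gt1 p_le_q mH'
  (fine_ge0 N0) (esym (fineK Nfin)).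
rewrite -/B -/D /= => le_int.
rewrite NE -(fineK Nfin) poweR_EFin -EFinM.
(* Since [(q / p) / q = 1 / p], the [q]-th root restores the [p]-norm from its [p]-th power [N]. *)
have -> : D `^ q^-1 * fine N `^ p^-1 = (D * fine N `^ (q / p)) `^ q^-1.
  rewrite powRM ?powR_ge0// -powRrM; congr (_ * _ `^ _).
  by field; rewrite !gt_eqF.
rewrite unlock -poweR_EFin; apply: gt0_ler_poweR.
- by rewrite invr_ge0 ltW.
- by rewrite in_itv/= leey andbT integral_ge0// => x _; exact: poweR_ge0.
- by rewrite in_itv/= leey andbT lee_fin mulr_ge0 ?powR_ge0.
(* The norm integrates over the whole line; off []0, +oo[] the integrand is 0 to the power [q],
   which vanishes because [q != 0]. *)
apply: le_trans le_int; rewrite [leRHS]integral_mkcond.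
rewrite le_eqVlt; apply/orP; left; apply/eqP; apply: eq_integral => x _.
rewrite !patchE; case: ifP => // _.
by rewrite abse0 poweR0r// gt_eqF.
Qed.
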